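(* The monoid $E=\mathrm{End}(\mathbb{Q},betw)$ has automatic homeomorphicity: for every countable set $\Omega$ and every monoid isomorphism $\theta$ from $E$ onto a closed submonoid of $Tr(\Omega)$, $\theta$ is a homeomorphism.
   Context: On $\mathbb{Q}$ the (reflexive) betweenness relation is $betw(x,y,z)$ iff $x\le y\le z$ or $z\le y\le x$. $\mathrm{End}(\mathbb{Q},betw)$ is the monoid of all maps $f:\mathbb{Q}\to\mathbb{Q}$ (not necessarily injective) such that $betw(x,y,z)$ implies $betw(f(x),f(y),f(z))$. For a countable set $X$, $Tr(X)$ is the monoid of all maps $X\to X$. Transformation monoids carry the topology of pointwise convergence, whose basic open sets are $\{f : f(b_k)=c_k \text{ for } k=1,\dots,n\}$ for finite tuples of points. *)

(* Defs.v *)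
From HB Require Import structures.
From mathcomp Require Import all_boot all_order all_algebra.
From mathcomp Require Import all_classical topology.

Set Implicit Arguments.
Unset Strict Implicit.
Unset Printing Implicit Defensive.

Local Open Scope classical_set_scope.

(* Pointwise convergence with X discrete: the sets of maps with prescribed
   values at finitely many points form a base.  Neither an order nor a metric
   on X plays any role, even when X is rat. *)
Definition Tr (X : choiceType) : Type := {ptws X -> discrete_topology X}.

Section FullTransformationMonoid.
Variable X : choiceType.

HB.instance Definition _ := Topological.on (Tr X).

Definition Tr_one : Tr X := fun x => x.
Definition Tr_mul (f g : Tr X) : Tr X := fun x => f (g x).

Lemma Tr_mulA : associative Tr_mul. Proof. by []. Qed.
Lemma Tr_mul1 : left_id Tr_one Tr_mul. Proof. by []. Qed.
Lemma Tr_mulr1 : right_id Tr_one Tr_mul. Proof. by []. Qed.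

HB.instance Definition _ :=
  isMonoid.Build (Tr X) Tr_mulA Tr_mul1 Tr_mulr1.

End FullTransformationMonoid.

Record submonoid (X : choiceType) := Submonoid {
  submonoid_set :> set (Tr X);
  submonoid_closed : monoid_closed (mem submonoid_set)
}.

(* The elements of a submonoid form the library's subtype set_type, whose
   topology is the one induced by the inclusion into Tr X. *)
Section SubmonoidType.
Variables (X : choiceType) (M : submonoid X).

Definition submonoid_one : M := exist _ 1%g (submonoid_closed M).1.
Definition submonoid_mul (f g : M) : M :=
  exist _ (val f * val g)%g
    ((submonoid_closed M).2 (val f) (val g) (valP f) (valP g)).

Lemma submonoid_mulA : associative submonoid_mul.
Proof. by move=> f g h; apply/val_inj/mulgA. Qed.
Lemma submonoid_mul1 : left_id submonoid_one submonoid_mul.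
Proof. by move=> f; apply/val_inj/mul1g. Qed.
Lemma submonoid_mulr1 : right_id submonoid_one submonoid_mul.
Proof. by move=> f; apply/val_inj/mulg1. Qed.

HB.instance Definition _ :=
  isMonoid.Build (set_type (submonoid_set M))
    submonoid_mulA submonoid_mul1 submonoid_mulr1.

End SubmonoidType.

Definition monoid_isomorphism (G H : monoidType) (theta : G -> H) : Prop :=
  bijective theta /\ monoid_morphism theta.

Definition homeomorphism (S T : topologicalType) (f : S -> T) : Prop :=
  exists g : T -> S,
    [/\ cancel f g, cancel g f, continuous f & continuous g].

Definition automatic_homeomorphicity (X : choiceType) (E : submonoid X) : Prop :=
  forall (Omega : countType) (M : submonoid Omega) (theta : E -> M),
    closed (submonoid_set M) -> monoid_isomorphism theta -> homeomorphism theta.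

Definition betw (x y z : rat) : bool :=
  (x <= y <= z)%R || (z <= y <= x)%R.

Definition End_betw_set : set (Tr rat) :=
  [set f | forall x y z, betw x y z -> betw (f x) (f y) (f z)].

Lemma End_betw_closed : monoid_closed (mem End_betw_set).
Proof.
split=> [|f g]; first by rewrite inE.
by rewrite !inE => Ef Eg x y z /Eg; exact: Ef.
Qed.

Definition End_betw : submonoid rat := Submonoid End_betw_closed.

(* Main.v *)
(** The constant maps form a copy of [rat] on which the monoid [E] acts
    naturally by left multiplication.  Evaluating their images under [theta] at
    one well-chosen point embeds [rat] equivariantly into [Omega]; this makes
    the inverse of [theta] continuous at once.

    For the continuity of [theta], let [e_n x] be the greatest of the first [n]
    rationals that is at most [x], or a common lower bound of them if there is
    none.  Then [e_n] has finite image and tends to the identity.  If, for each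
    [w], [theta e_n w] is eventually constant, then [theta e_n] converges
    pointwise; its limit lies in the closed set [M], and the embedded copy of
    [rat] identifies it with [theta 1].  So [theta e_n w = w] for some [n], and
    [theta f w = theta (f e_n) w] depends only on the values of [f] on a finite
    set.

    That [theta e_n w] is eventually constant is a pigeonhole argument: among
    the [branch i], continuum many strictly increasing maps indexed by
    [i : nat -> bool], two have the same value [theta (branch i) w].  If [n] is
    the first place where [i] and [j] differ, the two maps agree at the first
    [n] rationals, but between consecutive ones all values of [branch i] lie on
    one side of all values of [branch j].  Hence a single [h] in [E] turns
    [branch j] into [e_k] and [branch i] into a version of [e_n], for every
    [k >= n].

    Closedness of [M] matters here: sending an increasing map to whether it is
    bounded above gives a discontinuous action of the increasing maps on two
    points. *)
From mathcomp Require Import all_boot all_order all_algebra.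
From mathcomp Require Import all_classical topology.
From mathcomp Require Import zify lra.
Require Import Defs.

Set Implicit Arguments.
Unset Strict Implicit.
Unset Printing Implicit Defensive.

Import Order.TTheory GRing.Theory Num.Theory.
Local Open Scope ring_scope.

(** * Truncated expansions in base 6 *)

Definition radix6 (s : nat -> nat) (n : nat) : rat :=
  \sum_(k < n) (s k)%:R / 6 ^+ k.+1.

Lemma radix6S s n : radix6 s n.+1 = radix6 s n + (s n)%:R / 6 ^+ n.+1.
Proof. by rewrite /radix6 big_ord_recr. Qed.

Lemma eq_radix6 s t n :
  (forall k, (k < n)%N -> s k = t k) -> radix6 s n = radix6 t n.
Proof. by move=> st; apply: eq_bigr => k _; rewrite st. Qed.

Lemma radix6_le s m n : (m <= n)%N -> radix6 s m <= radix6 s n.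
Proof.
move=> /subnK<-; elim: (n - m)%N => // d IH; rewrite addSn radix6S.
by apply: le_trans IH _; rewrite lerDl divr_ge0 // exprn_ge0.
Qed.

Lemma radix6_tail s m n : (forall k, (s k < 6)%N) -> (m <= n)%N ->
  radix6 s n + (6 ^+ n)^-1 <= radix6 s m + (6 ^+ m)^-1.
Proof.
move=> s6 /subnK<-; elim: (n - m)%N => // d IH; rewrite addSn radix6S.
apply: le_trans IH; rewrite -addrA lerD2l; set e := (d + m)%N.
have e6 : 0 < (6 ^+ e.+1)^-1 :> rat by rewrite invr_gt0 exprn_gt0.
have -> : (6 ^+ e)^-1 = 6 * (6 ^+ e.+1)^-1 :> rat.
  by rewrite exprS invfM mulrA divff // mul1r.
have : (s e)%:R <= 5 :> rat by rewrite (ler_nat _ _ 5) -ltnS.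
by nra.
Qed.

(** The digits of [s] past place [k] form a finite sum, which stays strictly below one unit of that
    place. *)
Lemma radix6_lt s t k m n : (forall l, (s l < 6)%N) ->
  (forall l, (l < k)%N -> s l = t l) -> (s k < t k)%N -> (k < n)%N ->
  radix6 s m < radix6 t n.
Proof.
move=> s6 st stk kn; apply: lt_le_trans (radix6_le t kn).
have [mk|km] := leqP m k.
  apply: le_lt_trans (radix6_le s mk) _.
  rewrite radix6S (eq_radix6 st) ltrDl divr_gt0 ?exprn_gt0 // ltr0n.
  exact: leq_ltn_trans stk.
apply: (@lt_le_trans _ _ (radix6 s m + (6 ^+ m)^-1)).
  by rewrite ltrDl invr_gt0 exprn_gt0.
apply: le_trans (radix6_tail s6 km) _; rewrite !radix6S (eq_radix6 st) -addrA.
rewrite lerD2l -[X in _ + X]mul1r -mulrDl.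
by rewrite ler_pM2r ?invr_gt0 ?exprn_gt0 // natr1 ler_nat.
Qed.

(** * A continuum of strictly increasing maps *)

Definition side (k : nat) (x : rat) : nat :=
  if @pickle_inv rat k is Some q then ((q <= x)%R + (q < x)%R)%N else 0%N.

(* The last digit kept is the one at which x is compared with itself; the sum
   must be finite for the value to be rational. *)
Definition branch (i : nat -> bool) (x : rat) : rat :=
  radix6 (fun k => 3 * i k + side k x)%N (pickle x).+1.

Lemma side_le2 k x : (side k x <= 2)%N.
Proof. rewrite /side; by case: pickle_inv => // q; case: (q <= x); case: (q < x). Qed.

Lemma side_gt k x y : (side k y < side k x)%N ->
  exists2 q : rat, pickle q = k & y <= q <= x.
Proof.
rewrite /side; have := @pickle_invK rat k; rewrite /obind.
case: pickle_inv => //= q qk yx; exists q => //; move: yx.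
by case: (ltgtP q x) => ?; case: (ltgtP q y).
Qed.

Lemma side_pickle x y : side (pickle x) x = side (pickle x) y -> x = y.
Proof. by rewrite /side pickleK_inv lexx ltxx; case: ltgtP. Qed.


(** The first differing digit decides. Below [n] it comes from the sides, ordered by the second
    hypothesis; failing that, the bits at [n] decide, since their weight 3 exceeds any side. *)
Lemma branch_lt (i j : nat -> bool) n (x y : rat) :
  (forall k, (k < n)%N -> i k = j k) ->
  (forall q : rat, (pickle q < n)%N -> ~~ (y <= q <= x)) ->
  ((forall k, (k < n)%N -> side k x = side k y) -> ~~ i n && j n) ->
  branch i x < branch j y.
Proof.
move=> ij sep ijn.
have digit6 k : (3 * i k + side k x < 6)%N.
  by have := side_le2 k x; case: (i k) => /=; lia.
have lt_at k : (k <= n)%N -> (k <= pickle y)%N ->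
    (forall l, (l < k)%N -> side l x = side l y) ->
    (3 * i k + side k x < 3 * j k + side k y)%N -> branch i x < branch j y.
  move=> kn ky agree digit_lt; apply: (@radix6_lt _ _ k) => // l lk.
  by rewrite agree // ij // (leq_trans lk kn).
(* Place [pickle y] tells [y] apart from every other point, so the expansion of [y] reaches place
   [k]. *)
have agree_pickle k : (forall l, (l < k)%N -> side l x = side l y) ->
    x <> y -> (k <= pickle y)%N.
  move=> agree xy; rewrite leqNgt; apply/negP => yk.
  by apply: xy; apply/esym/side_pickle/esym/agree.
have [agree|] := pselect (forall k, (k < n)%N -> side k x = side k y).
  have /andP[/negbTE in0 jn1] := ijn agree; apply: (lt_at n) => //; last first.
    by rewrite in0 jn1 /=; have := side_le2 n x; lia.
  have [exy|/eqP xy] := eqVneq x y; last exact: agree_pickle.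
  by rewrite leqNgt; apply/negP => /sep; rewrite exy lexx.
move=> /existsNP[k0 /not_implyP[k0n /eqP k0xy]].
have ex_diff : exists k, (k < n)%N && (side k x != side k y).
  by exists k0; rewrite k0n.
case: (ex_minnP ex_diff) => k /andP[kn kxy] kmin.
have agree l : (l < k)%N -> side l x = side l y.
  move=> lk; apply: contraTeq lk => lxy; rewrite -leqNgt.
  have [ln|nl] := ltnP l n; first by rewrite kmin // ln.
  exact: leq_trans (ltnW kn) nl.
have ky : (k <= pickle y)%N.
  by apply: agree_pickle => // exy; rewrite exy eqxx in kxy.
apply: (lt_at k) => //; first exact: ltnW.
rewrite ij // ltn_add2l; case: ltngtP kxy => // yx _.
by have [q qk] := side_gt yx; rewrite -qk in kn; rewrite (negbTE (sep q kn)).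
Qed.

Lemma branch_strict i x y : (branch i x < branch i y) = (x < y).
Proof.
suff lt x' y' : x' < y' -> branch i x' < branch i y'.
  apply/idP/idP; last exact: lt.
  by apply: contraTT; rewrite -!leNgt le_eqVlt => /orP[/eqP->//|/lt/ltW].
(* Place [pickle x'] already separates [x'] from [y'], which makes the last premise vacuous. *)
move=> xy; apply: (@branch_lt _ _ (pickle x').+1) => // [q _|agree].
  by apply/negP => /andP[yq /(le_trans yq)]; rewrite leNgt xy.
by have := side_pickle (agree _ (ltnSn _)) => exy; rewrite exy ltxx in xy.
Qed.

Lemma branch_le i x y : (branch i x <= branch i y) = (x <= y).
Proof. by rewrite !leNgt branch_strict. Qed.

Lemma branch_le_split (i j : nat -> bool) n x y :
  (forall k, (k < n)%N -> i k = j k) -> i n = false -> j n = true ->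
  reflect (exists2 q : rat, (pickle q < n)%N & y <= q <= x)
    (branch j y <= branch i x).
Proof.
move=> ij in0 jn1; apply: (iffP idP) => [|[q qn /andP[yq qx]]].
  apply: contraTP => /forall2NP sep; rewrite -ltNge.
  apply: branch_lt ij _ _ => [q qn|_]; last by rewrite in0 jn1.
  by apply/negP => yqx; case: (sep q).
apply: (@le_trans _ _ (branch i q)); last by rewrite branch_le.
(* Only digits up to place [pickle q] enter, and there [i] and [j] agree. *)
suff -> : branch i q = branch j q by rewrite branch_le.
by apply: eq_radix6 => k kq; rewrite ij // (leq_trans kq).
Qed.

(** * Step maps with finite image *)

Definition pts (n : nat) : seq rat := pmap (@pickle_inv rat) (iota 0 n).

Lemma mem_pts n q : (q \in pts n) = (pickle q < n)%N.
Proof.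
apply/idP/idP => [|qn].
  rewrite /pts mem_pmap => /mapP[k]; rewrite mem_iota add0n => /andP[_ kn] qk.
  by have := @pickle_invK rat k; rewrite /obind -qk /= => ->.
by rewrite /pts mem_pmap -(@pickleK_inv rat) map_f // mem_iota.
Qed.

Definition lmax (s : seq rat) (c : rat) (P : pred rat) : rat :=
  \big[Order.max/c]_(q <- s | P q) q.

Lemma lmax_le (s : seq rat) (c : rat) (P : pred rat) m :
  c <= m -> (forall q, q \in s -> P q -> q <= m) -> lmax s c P <= m.
Proof.
move=> cm sm; rewrite /lmax big_seq_cond; apply: bigmax_le => // q.
by case/andP; exact: sm.
Qed.

Lemma lmax_ge_id s c P : c <= lmax s c P.
Proof. exact: bigmax_ge_id. Qed.

Lemma lmax_ge (s : seq rat) (c : rat) (P : pred rat) q : q \in s -> P q -> q <= lmax s c P.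
Proof. by move=> qs Pq; apply: (@le_bigmax_seq _ _ _ _ _ q _ id). Qed.

Lemma lmax_mem s c P : lmax s c P \in c :: s.
Proof.
rewrite /lmax big_seq_cond; elim/big_ind: _ => [|p q ps qs|q /andP[qs _]].
- exact: mem_head.
- by rewrite maxEle; case: ifP.
- by rewrite inE qs orbT.
Qed.

Lemma homo_betw (f : rat -> rat) :
  {homo f : x y / x <= y} -> End_betw_set f.
Proof.
move=> fle x y z /orP[]/andP[/fle xy /fle yz].
  by apply/orP; left; apply/andP.
by apply/orP; right; apply/andP.
Qed.

Definition endo (f : rat -> rat) (fle : {homo f : x y / x <= y}) : End_betw :=
  exist _ (f : Tr rat) (mem_set (homo_betw fle)).

Definition step (n : nat) (c x : rat) : rat := lmax (pts n) c (<= x).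

Lemma step_homo n c : {homo step n c : x y / x <= y}.
Proof.
move=> x y xy; apply: lmax_le => [|q qn qx]; first exact: lmax_ge_id.
by apply: lmax_ge => //; exact: le_trans xy.
Qed.

Lemma step_pts n c q : q \in pts n -> c <= q -> step n c q = q.
Proof.
move=> qn cq; apply/le_anti/andP; split; last by apply: lmax_ge; rewrite /= ?lexx.
exact: lmax_le.
Qed.

Lemma branch_homo i : {homo branch i : x y / x <= y}.
Proof. by move=> x y; rewrite branch_le. Qed.

(* The two lower bounds c <= d let one map step n c serve as the collapse of all
   step k d, whose own default values must decrease to -oo with k. *)
Lemma branch_collapse (i j : nat -> bool) n k c d :
  (forall l, (l < n)%N -> i l = j l) -> i n = false -> j n = true ->
  (n <= k)%N -> c <= d -> (forall q, q \in pts k -> d <= q) ->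
  exists h : End_betw, val h \o branch i = step n c /\
                       val h \o branch j = step k d.
Proof.
move=> ij in0 jn1 nk cd dk.
have split x y := branch_le_split x y ij in0 jn1.
(* The default is [d] all along [branch j]. A value of [branch i] is hit only past some point of
   [pts n], which is at least [d] anyway. *)
pose hit z := `[< exists y, branch j y <= z >].
pose h z := lmax (pts k) (if hit z then d else c) (fun q => branch j q <= z).
have hle : {homo h : x y / x <= y}.
  move=> x y xy; apply: lmax_le => [|q qk qx]; last first.
    by apply: lmax_ge => //; exact: le_trans xy.
  apply: le_trans (lmax_ge_id _ _ _); rewrite /hit.
  case: asboolP => [[z zx]|_]; last by case: asboolP.
  by rewrite asboolT //; exists z; exact: le_trans xy.
exists (endo hle); split; apply/funext => x /=; last first.
  rewrite /h /step /hit asboolT; last by exists x.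
  by rewrite /lmax; apply: eq_bigl => q; rewrite branch_le.
apply/le_anti/andP; split; rewrite /h; last first.
  apply: lmax_le => [|q qn qx].
    by apply: le_trans (lmax_ge_id _ _ _); case: ifP.
  apply: lmax_ge; first by rewrite mem_pts (leq_trans _ nk) // -mem_pts.
  by apply/split; exists q; rewrite -?mem_pts // lexx.
(* A point of [pts n] lies between [q] and [x], so the extra points of [pts k] do not raise the
   maximum. *)
apply: lmax_le => [|q _ /split[q' q'n /andP[qq' q'x]]]; last first.
  by apply: le_trans qq' _; apply: lmax_ge; rewrite ?mem_pts.
rewrite /hit; case: asboolP => [[y /split[q qn /andP[_ qx]]]|_].
  apply: (@le_trans _ _ q); last by apply: lmax_ge; rewrite ?mem_pts.
  by apply: dk; rewrite mem_pts (leq_trans qn).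
exact: lmax_ge_id.
Qed.

(** * Pigeonhole and eventual constancy *)

Lemma seq_lower_bound (s : seq rat) : exists c, forall q, q \in s -> c <= q.
Proof.
elim: s => [|p s [c cs]]; first by exists 0.
exists (Order.min p c) => q; rewrite inE => /orP[/eqP->|/cs].
  by rewrite ge_min lexx.
by move=> cq; rewrite ge_min cq orbT.
Qed.

Lemma Cantor_countable (Omega : countType) (F : (nat -> bool) -> Omega) :
  exists i j, F i = F j /\ i <> j.
Proof.
apply: contrapT => /forallNP Finj.
have {}Finj i j : F i = F j -> i = j.
  by move=> Fij; apply: contrapT => ij; case: (Finj i); exists j.
pose d n := `[< exists i, pickle (F i) = n /\ i n = false >].
have := erefl (d (pickle (F d))); rewrite {1}/d; case: asboolP.
  by case=> i [/(pcan_inj pickleK)/Finj->] ->.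
by move=> nd /esym dd; apply: nd; exists d.
Qed.

Lemma branch_pigeonhole (Omega : countType) (F : (nat -> bool) -> Omega) :
  exists n i j, [/\ F i = F j, forall l, (l < n)%N -> i l = j l,
                    i n = false & j n = true].
Proof.
have [i [j [Fij ij]]] := Cantor_countable F.
have /existsNP[l0 /eqP l0P] : ~ forall l, i l = j l.
  by move=> eq_ij; apply: ij; apply/funext.
have ex_diff : exists l, i l != j l by exists l0.
case: (ex_minnP ex_diff) => n nij nmin.
have agree l : (l < n)%N -> i l = j l.
  by move=> ln; apply: contraTeq ln => /nmin; rewrite -leqNgt.
exists n; case ein: (i n); case ejn: (j n); rewrite ?ein ?ejn // in nij.
  by exists j, i; split=> // l /agree.
by exists i, j.
Qed.

Lemma step_eventually_constant (Omega : countType) (F : End_betw -> Omega) :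
  (forall h f g : End_betw, F f = F g -> F (h * f)%g = F (h * g)%g) ->
  exists n, forall k l c d, (n <= k)%N -> (n <= l)%N ->
    (forall q, q \in pts k -> c <= q) -> (forall q, q \in pts l -> d <= q) ->
    F (endo (@step_homo k c)) = F (endo (@step_homo l d)).
Proof.
move=> Fmul.
have [n [i [j [Fij agree in0 jn1]]]] :=
  branch_pigeonhole (fun i => F (endo (@branch_homo i))).
exists n => k l c d nk nl ck dl.
(* Both sides are compared with [step n] at the common lower bound [min c d]. *)
suff to_n m e b : (n <= m)%N -> (forall q, q \in pts m -> e <= q) -> b <= e ->
    F (endo (@step_homo m e)) = F (endo (@step_homo n b)).
  rewrite (to_n k c (Order.min c d)) ?ge_min ?lexx //.
  by rewrite (to_n l d (Order.min c d)) ?ge_min ?lexx ?orbT.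
move=> nm em be.
have [h [hi hj]] := branch_collapse agree in0 jn1 nm be em.
have -> : endo (@step_homo m e) = (h * endo (@branch_homo j))%g.
  by apply/val_inj; rewrite /= -hj.
have -> : endo (@step_homo n b) = (h * endo (@branch_homo i))%g.
  by apply/val_inj; rewrite /= -hi.
exact/esym/Fmul.
Qed.

Local Open Scope classical_set_scope.

(** * Pointwise convergence on submonoids *)

Lemma near_eval (X : choiceType) (M : submonoid X) (f : M) (x : X) :
  \forall g \near f, val g x = val f x.
Proof.
have val_cont : continuous (val : M -> Tr X) := @initial_continuous _ _ _.
have eval_cont : continuous (fun g : Tr X => g x : discrete_topology X).
  exact: (@proj_continuous X (fun=> discrete_topology X) x).
exact: (val_cont _ _ (eval_cont _ _ (discrete_set1 _))).
Qed.

Lemma near_eval_seq (X : choiceType) (M : submonoid X) (f : M) (s : seq X) :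
  \forall g \near f, forall x, x \in s -> val g x = val f x.
Proof.
elim: s => [|x s IH]; first by near=> g.
near=> g; have gx : val g x = val f x by near: g; exact: near_eval.
by move=> y; rewrite inE => /orP[/eqP->//|]; move: y; near: g.
Unshelve. all: by end_near. Qed.

Lemma cvg_Tr (X : choiceType) (T : Type) (F : set_system T) (u : T -> Tr X)
    (l : Tr X) : Filter F ->
  (forall x, \forall t \near F, u t x = l x) -> u @ F --> l.
Proof.
move=> FF ul; apply/cvg_sup => x A [_ [[B _ <-] Bl AB]].
by apply: filterS (ul x) => t ut; apply: AB; rewrite /= /proj ut.
Qed.

Lemma continuous_submonoid (X Y : choiceType) (M : submonoid X)
    (N : submonoid Y) (phi : M -> N) :
  (forall y f, exists s : seq X, forall g : M,
     (forall x, x \in s -> val g x = val f x) ->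
     val (phi g) y = val (phi f) y) ->
  continuous phi.
Proof.
move=> loc; apply: continuous_comp_initial => f.
apply: (@cvg_Tr Y M _ _ _ (nbhs_filter f)) => y; have [s sP] := loc y f.
by apply: filterS (near_eval_seq f s) => g; exact: sP.
Qed.

(** * Constant maps and continuity of the isomorphism *)

Lemma cst_homo (q : rat) : {homo (fun _ : rat => q) : x y / x <= y}.
Proof. by []. Qed.

Definition cst (q : rat) : End_betw := endo (@cst_homo q).

Lemma mul_cst (f : End_betw) q : (f * cst q)%g = cst (val f q).
Proof. exact/val_inj. Qed.

Section Isomorphism.
Variables (Omega : countType) (M : submonoid Omega) (theta : End_betw -> M).
Hypothesis theta_bij : bijective theta.
Hypothesis theta1 : theta 1%g = 1%g.
Hypothesis thetaM : {morph theta : f g / (f * g)%g}.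

Let theta_inj : injective theta := bij_inj theta_bij.
Let act f w := val (theta f) w.

Lemma act_mul f g w : act (f * g)%g w = act f (act g w).
Proof. by rewrite /act thetaM. Qed.

(* Evaluating the images of the constant maps at a point where those of 0 and 1
   differ turns the natural action on rat into a subaction of theta. *)
Lemma equivariant_embedding : exists iota : rat -> Omega,
  injective iota /\ forall f q, act f (iota q) = iota (val f q).
Proof.
have [w w01] : exists w, act (cst 0) w <> act (cst 1) w.
  apply/existsNP => eq01.
  have /theta_inj/(congr1 (fun f : End_betw => val f 0)) :
    theta (cst 0) = theta (cst 1).
    by apply/val_inj/funext.
  by move/eqP; rewrite eq_sym oner_eq0.
exists (fun q => act (cst q) w); split => [|f q]; last by rewrite -act_mul mul_cst.
suff lt p q : p < q -> act (cst p) w <> act (cst q) w.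
  by move=> p q pq; case: (ltgtP p q) => // /lt; rewrite pq.
move=> pq eqpq; apply: w01.
(* The jump just after [p] sends [p] to 0 and [q] to 1, carrying a coincidence at [p], [q] to one at
   0, 1. *)
have jump_homo : {homo (fun x : rat => (p < x)%R%:R : rat) : x y / x <= y}.
  by move=> x y xy; rewrite ler_nat; case: (ltP p x) => // /lt_le_trans->.
have jump x : cst (p < x)%R%:R = (endo jump_homo * cst x)%g by rewrite mul_cst.
have := congr1 (act (endo jump_homo)) eqpq.
by rewrite -!act_mul -!jump ltxx pq.
Qed.

Lemma act_step : closed (submonoid_set M) ->
  forall w, exists n c, act (endo (@step_homo n c)) w = w.
Proof.
move=> Mclosed w.
have [c cP] := choice (fun n => seq_lower_bound (pts n)).
pose e n := endo (@step_homo n (c n)).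
have stab v : exists n, forall k, (n <= k)%N -> act (e k) v = act (e n) v.
  have [|n nP] := @step_eventually_constant Omega (fun f => act f v).
    by move=> h f g fg; rewrite !act_mul fg.
  by exists n => k nk; exact: nP nk (leqnn n) (cP k) (cP n).
have [n nP] := choice stab.
pose lim : Tr Omega := fun v => act (e (n v)) v.
have Mlim : submonoid_set M lim.
  apply: (closed_cvg (F := \oo) (u_ := fun k => val (theta (e k)))) => //.
    by apply: nearW => k; apply/set_mem/valP.
  by apply: cvg_Tr => v; exists (n v) => // k; exact: nP.
have [g gP] : exists g, theta g = exist _ lim (mem_set Mlim).
  have [theta' _ thetaK] := theta_bij.
  by exists (theta' (exist _ lim (mem_set Mlim))).
have actg v : act g v = lim v by rewrite /act gP.
have [iota [iota_inj iotaP]] := equivariant_embedding.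
have g1 : g = 1%g.
  apply/val_inj/funext => q; apply: iota_inj; rewrite -iotaP actg.
  (* Past both the stabilisation index at [iota q] and the code of [q], so that [e k] fixes [q]. *)
  pose k := maxn (n (iota q)) (pickle q).+1.
  rewrite /lim -(nP _ k) ?leq_maxl // iotaP /=.
  have qk : q \in pts k by rewrite mem_pts leq_maxr.
  by rewrite step_pts //; exact: cP.
exists (n w), (c (n w)).
by have := actg w; rewrite g1 /act theta1 => /esym.
Qed.

Lemma continuous_theta : closed (submonoid_set M) -> continuous theta.
Proof.
move=> Mclosed; apply: continuous_submonoid => w f.
have [n [c ecw]] := act_step Mclosed w.
(* This list contains the image of [step n c], so it determines [g * step n c]. *)
exists (c :: pts n) => g fg.
have factor (h : End_betw) :
    val (theta h) w = act (h * endo (@step_homo n c))%g w by rewrite act_mul ecw.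
rewrite !factor.
by congr (act _ w); apply/val_inj/funext => x /=; apply: fg; exact: lmax_mem.
Qed.

(** Equivariance lets the value of [theta' t] at [q] be read off from [t] at the single point
    [iota q]. *)
Lemma continuous_inverse (theta' : M -> End_betw) :
  cancel theta' theta -> continuous theta'.
Proof.
move=> thetaK; apply: continuous_submonoid => q t.
have [iota [iota_inj iotaP]] := equivariant_embedding.
exists [:: iota q] => t' tt'; apply: iota_inj.
by rewrite -!iotaP /act !thetaK tt' // mem_head.
Qed.

End Isomorphism.

Theorem theorem2p7 : automatic_homeomorphicity End_betw.
Proof.
move=> Omega M theta Mclosed [theta_bij [theta1 thetaM]].
have [theta' thetaK theta'K] := theta_bij.
exists theta'; split=> //; last exact: (continuous_inverse theta_bij thetaM).
exact: (continuous_theta theta_bij theta1 thetaM).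
Qed.
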